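(* Fix integers $h\ge1$ and $w\ge2$. Let $\{x_t\}$ (scalar) and $\{\mathbf{y}_t\}$ ($\mathbb{R}^w$-valued) be weakly stationary, mean-zero processes with $\mathbf{y}_{t+h}=\boldsymbol{\beta}_hx_t+\boldsymbol{\varepsilon}_t^{(h)}$, $\boldsymbol{\beta}_h\in\mathbb{R}^w$ deterministic, and let $R=\mathbb{E}[x_1^2]\ne0$. Let $\mathbf{C}_{h,s}=\mathbb{E}\left[\left(x_t\boldsymbol{\varepsilon}_t^{(h)}\right)\left(x_{t+s}\boldsymbol{\varepsilon}_{t+s}^{(h)}\right)^\top\right]$. Suppose that for each $0\le s\le h-1$, as $n\to\infty$: (1) $n^{-1}\sum_{t=1}^n\boldsymbol{\varepsilon}_t^{(h)}\boldsymbol{\varepsilon}_t^{(h)\top}=\mathbb{E}\left[\boldsymbol{\varepsilon}_1^{(h)}\boldsymbol{\varepsilon}_1^{(h)\top}\right]+O_p(n^{-1/2})$; (2) $n^{-1}\sum_{t=1}^n\left(x_t\boldsymbol{\varepsilon}_t^{(h)}\right)\left(x_{t+s}\boldsymbol{\varepsilon}_{t+s}^{(h)}\right)^\top=\mathbf{C}_{h,s}+o_p(1)$; (3) $n^{-1/2}\sum_{t=1}^nx_t\boldsymbol{\varepsilon}_t^{(h)}=O_p(1)$; (4) $n^{-1}\sum_{t=1}^nx_t^2=R+o_p(1)$; (5) $\sup_{-\infty<t<\infty}\mathbb{E}\left[\|\boldsymbol{\varepsilon}_t^{(h)}\|^4\right]+\sup_{-\infty<t<\infty}\mathbb{E}\left[|x_t|^4\right]<\infty$.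 Then $$\widehat{\mathbf{MI}}_h=\mathbf{MI}_h+O_p(n^{-1/2}),\qquad \widehat{\mathbf{VI}}_h=\mathbf{VI}_h+o_p(1),$$ where $$\mathbf{MI}_h=\mathbb{E}\left[\boldsymbol{\varepsilon}_t^{(h)}\boldsymbol{\varepsilon}_t^{(h)\top}\right],\qquad \mathbf{VI}_h=R^{-1}\left(\mathbf{C}_{h,0}+\sum_{s=1}^{h-1}\left(\mathbf{C}_{h,s}+\mathbf{C}_{h,s}^\top\right)\right),$$ and, with $N=n-h$, $$\widehat{\mathbf{MI}}_h=N^{-1}\sum_{t=1}^N\hat{\boldsymbol{\varepsilon}}_t\hat{\boldsymbol{\varepsilon}}_t^\top,\qquad \widehat{\mathbf{VI}}_h=\hat R^{-1}\left[\hat{\mathbf{C}}_{h,0}+\sum_{s=1}^{h-1}\left(\hat{\mathbf{C}}_{h,s}+\hat{\mathbf{C}}_{h,s}^\top\right)\right],$$ $$\hat{\mathbf{C}}_{h,s}=(N-s)^{-1}\sum_{t=1}^{N-s}x_tx_{t+s}\hat{\boldsymbol{\varepsilon}}_t\hat{\boldsymbol{\varepsilon}}_{t+s}^\top,\quad \hat R=N^{-1}\sum_{t=1}^Nx_t^2,\quad \hat{\boldsymbol{\varepsilon}}_t=\mathbf{y}_{t+h}-\hat{\boldsymbol{\beta}}_n(h)x_t,\quad \hat{\boldsymbol{\beta}}_n(h)=\hat R^{-1}\left(N^{-1}\sum_{t=1}^Nx_t\mathbf{y}_{t+h}\right).$$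
   Context: The processes are indexed by $t\in\mathbb{Z}$ on a probability space $(\Omega,\mathcal{F},\mathbb{P})$; $h$ and $w$ are fixed while $n\to\infty$. The sample of size $n$ is split into a training set $[1,N]$ and a test set $[N+1,N+h]$, so $n=N+h$. The vector $\boldsymbol{\varepsilon}_t^{(h)}:=\mathbf{y}_{t+h}-\boldsymbol{\beta}_hx_t$ is the $h$-step ahead forecast error. The notation for $\mathbf{C}_{h,s}$ and $\mathbf{MI}_h$ presupposes that these expectations do not depend on $t$. $\|\cdot\|$ is the Euclidean norm for vectors and the induced operator norm for matrices. For random vectors or matrices $\mathbf{M}_n$ and scalars $c_n$, $\mathbf{M}_n=o_p(c_n)$ (resp. $O_p(c_n)$) means that $\|\mathbf{M}_n\|/c_n$ converges to $0$ in probability (resp. is bounded in probability). *)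

(* Defs.v *)
From HB Require Import structures.
From mathcomp Require Import all_boot all_order all_algebra.
From mathcomp Require Import all_classical all_reals all_analysis.

Set Implicit Arguments.
Unset Strict Implicit.
Unset Printing Implicit Defensive.

Import Order.TTheory GRing.Theory Num.Theory.
Import numFieldNormedType.Exports.

Local Open Scope classical_set_scope.
Local Open Scope ring_scope.

(* MathComp-Analysis equips matrices with the maximum norm, so the Euclidean
   norm and the operator norm it induces are defined here. *)
Definition vnorm (R : realType) (m : nat) (v : 'cV[R]_m) : R :=
  Num.sqrt (\sum_(i < m) v i ord0 ^+ 2).

Definition opnorm (R : realType) (m k : nat) (A : 'M[R]_(m, k)) : R :=
  sup [set vnorm (A *m v) | v in [set v : 'cV[R]_k | vnorm v <= 1]].

(* M_n = o_p(c_n) and M_n = O_p(c_n), for a norm nrm on the space V of values.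
   A real sequence of random variables is tight iff it is eventually so, hence
   bigO_p may ignore finitely many n; this also discards the n for which c_n or
   an estimator is not defined. *)
Definition littleo_p (d : measure_display) (T : measurableType d) (R : realType)
    (P : probability T R) (V : Type) (nrm : V -> R)
    (M : nat -> T -> V) (c : nat -> R) : Prop :=
  forall e : R, 0 < e ->
    P [set om | e < nrm (M n om) / c n] @[n --> \oo] --> 0%E.

Definition bigO_p (d : measure_display) (T : measurableType d) (R : realType)
    (P : probability T R) (V : Type) (nrm : V -> R)
    (M : nat -> T -> V) (c : nat -> R) : Prop :=
  forall e : R, 0 < e -> exists K : R,
    \forall n \near \oo, (P [set om | (K < nrm (M n om) / c n)%R] <= e%:E)%E.

Definition Emx (d : measure_display) (T : measurableType d) (R : realType)
    (P : probability T R) (m k : nat) (M : T -> 'M[R]_(m, k)) : 'M[R]_(m, k) :=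
  \matrix_(i, j) fine ('E_P[fun om => M om i j])%E.

(* Membership in Lfun P 2%:E includes measurability of the coordinate. *)
Definition weakly_stationary (d : measure_display) (T : measurableType d)
    (R : realType) (P : probability T R) (m : nat)
    (z : int -> T -> 'cV[R]_m) : Prop :=
  [/\ forall (t : int) (i : 'I_m), (fun om => z t om i ord0) \in Lfun P 2%:E,
      forall (t : int) (i : 'I_m),
        'E_P[fun om => z t om i ord0]%E = 'E_P[fun om => z 0%R om i ord0]%E
    & forall (s t : int) (i j : 'I_m),
        covariance P (fun om => z t om i ord0) (fun om => z (t + s) om j ord0) =
        covariance P (fun om => z 0 om i ord0) (fun om => z s om j ord0)].

Definition mean_zero (d : measure_display) (T : measurableType d)
    (R : realType) (P : probability T R) (m : nat)
    (z : int -> T -> 'cV[R]_m) : Prop :=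
  forall (t : int) (i : 'I_m), 'E_P[fun om => z t om i ord0]%E = 0%E.

Section Population.
Context (d : measure_display) (T : measurableType d) (R : realType).
Context (P : probability T R) (w : nat).
Context (x : int -> T -> R) (eps : int -> T -> 'cV[R]_w).

Definition xeps (t : int) (om : T) : 'cV[R]_w := x t om *: eps t om.

Definition err_moment (t : int) : 'M[R]_w :=
  Emx P (fun om => eps t om *m (eps t om)^T).

Definition score_moment (s : nat) (t : int) : 'M[R]_w :=
  Emx P (fun om => xeps t om *m (xeps (t + s%:Z) om)^T).

Definition x_moment2 : R := fine ('E_P[fun om => (x 1 om ^+ 2)%R])%E.

End Population.

(* The common shape of VI_h and its estimator. *)
Definition VI_of (R : realType) (w : nat) (h : nat) (r : R)
    (C : nat -> 'M[R]_w) : 'M[R]_w :=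
  r^-1 *: (C 0%N + \sum_(1 <= s < h) (C s + (C s)^T)).

(* The expectations defining MI_h and C_{h,s} are taken at t = 1; that they do
   not depend on t is a separate assumption where it is needed. *)
Definition MI (d : measure_display) (T : measurableType d) (R : realType)
    (P : probability T R) (w : nat) (eps : int -> T -> 'cV[R]_w) : 'M[R]_w :=
  err_moment P eps 1.

Definition Chs (d : measure_display) (T : measurableType d) (R : realType)
    (P : probability T R) (w : nat) (x : int -> T -> R)
    (eps : int -> T -> 'cV[R]_w) (s : nat) : 'M[R]_w :=
  score_moment P x eps s 1.

Definition VI (d : measure_display) (T : measurableType d) (R : realType)
    (P : probability T R) (w : nat) (h : nat) (x : int -> T -> R)
    (eps : int -> T -> 'cV[R]_w) : 'M[R]_w :=
  VI_of h (x_moment2 P x) (Chs P x eps).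

(* Estimators from a training set [1, N]. Division by zero yields 0, which
   fixes their value when Rhat = 0 or N <= s. *)
Section Estimators.
Context (T : Type) (R : realType) (w h N : nat).
Context (x : int -> T -> R) (y : int -> T -> 'cV[R]_w).

Definition Rhat (om : T) : R :=
  N%:R^-1 * \sum_(1 <= t < N.+1) x t%:Z om ^+ 2.

Definition beta_hat (om : T) : 'cV[R]_w :=
  (Rhat om)^-1 *:
    (N%:R^-1 *: \sum_(1 <= t < N.+1) x t%:Z om *: y (t%:Z + h%:Z) om).

Definition eps_hat (t : int) (om : T) : 'cV[R]_w :=
  y (t + h%:Z) om - x t om *: beta_hat om.

Definition MI_hat (om : T) : 'M[R]_w :=
  N%:R^-1 *: \sum_(1 <= t < N.+1) eps_hat t%:Z om *m (eps_hat t%:Z om)^T.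

Definition Chs_hat (s : nat) (om : T) : 'M[R]_w :=
  (N - s)%:R^-1 *: \sum_(1 <= t < (N - s).+1)
    (x t%:Z om * x (t%:Z + s%:Z) om) *:
      (eps_hat t%:Z om *m (eps_hat (t%:Z + s%:Z) om)^T).

Definition VI_hat (om : T) : 'M[R]_w :=
  VI_of h (Rhat om) (fun s => Chs_hat s om).

End Estimators.

(* Main.v *)
Require Import Defs.
From HB Require Import structures.
From mathcomp Require Import all_boot all_order all_algebra.
From mathcomp Require Import all_classical all_reals all_analysis.
From mathcomp Require Import measurable_realfun.
From mathcomp Require Import ring lra zify.

Set Implicit Arguments.
Unset Strict Implicit.
Unset Printing Implicit Defensive.

Import Order.TTheory GRing.Theory Num.Theory.
Import numFieldNormedType.Exports.

Local Open Scope classical_set_scope.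
Local Open Scope ring_scope.

(** Write [N] for [n - h], [q] for the mean of [x_t eps_t] over the training set,
    and [b = Rhat^-1 q]. On the training set [eps_hat t = eps t - x t b]
    ([eps_hatE]); this includes the event [Rhat = 0], on which [x] vanishes
    throughout [1, N]. Two exact identities follow, with no remainder.

    - [MI_hatE]: by the normal equation [Rhat b = q], the matrix [MI_hat] is the
      mean of [eps eps^T] minus [q b^T]. The third condition makes both [q] and
      [b] of order [N^(-1/2)], so the correction is of order [1/N], below the
      rate [n^(-1/2)] of the first condition.
    - [Chs_hatE]: [Chs_hat s] is the mean of the second condition plus three
      corrections, each a factor [b] (or two) times a mean of products of four
      of the variables [x_t], [x_(t+s)], [eps_t], [eps_(t+s)]. Bounded fourth
      moments bound the expectations of these products, hence by Markov's
      inequality the means are bounded in probability ([tight_mean]), and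
      [b -> 0] makes the corrections vanish.

    Everything is then a sum, product or inverse of real sequences that are
    bounded or convergent in probability ([tight], [cvg_prob]). The passage
    between matrices and their entries rests on
    [|A i j| <= opnorm A <= sum of the |A i j|].

    The remaining point is measurability: events such as [K < opnorm (M om)] must
    be measurable for their probabilities to be comparable. The operator norm is a
    supremum over an uncountable ball, but it is Lipschitz in the entries, and
    [measurable_lipschitz] reduces Lipschitz functions to countably many rational
    matrices. *)

(** * Euclidean and operator norms *)

Section MatrixNorms.
Context (R : realType).

Lemma vnorm_ge0 m (v : 'cV[R]_m) : 0 <= vnorm v.
Proof. exact: sqrtr_ge0. Qed.

Lemma sqr_vnorm m (v : 'cV[R]_m) : vnorm v ^+ 2 = \sum_(i < m) v i ord0 ^+ 2.
Proof. by rewrite sqr_sqrtr// sumr_ge0// => i _; exact: sqr_ge0. Qed.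

Lemma entry_le_vnorm m (v : 'cV[R]_m) i : `|v i ord0| <= vnorm v.
Proof.
rewrite -(@ler_pXn2r _ 2%N)// ?nnegrE ?vnorm_ge0// sqr_vnorm real_normK ?num_real//.
by rewrite (bigD1 i)//= lerDl sumr_ge0// => j _; exact: sqr_ge0.
Qed.

Lemma vnorm_eq0 m (v : 'cV[R]_m) : vnorm v = 0 -> v = 0.
Proof.
move=> v0; apply/matrixP => i j; rewrite (ord1 j) mxE.
by apply/eqP; rewrite -normr_le0 -v0 entry_le_vnorm.
Qed.

Lemma vnorm0 m : vnorm (0 : 'cV[R]_m) = 0.
Proof.
by rewrite /vnorm big1 ?sqrtr0// => i _; rewrite mxE expr0n.
Qed.

(** With [a], [b] the norms of [u], [v], expanding [(b u_i - a v_i)^2 >= 0]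
    bounds [a b (u_i + v_i)^2] by a combination of [u_i^2] and [v_i^2] whose
    sum over [i] is exactly [a b (a + b)^2]. *)
Lemma vnormD_le m (u v : 'cV[R]_m) : vnorm (u + v) <= vnorm u + vnorm v.
Proof.
have [u0|u0] := eqVneq (vnorm u) 0.
  by rewrite (vnorm_eq0 u0) add0r vnorm0 add0r.
have [v0|v0] := eqVneq (vnorm v) 0.
  by rewrite (vnorm_eq0 v0) addr0 vnorm0 addr0.
have a0 : 0 < vnorm u by rewrite lt_def u0 vnorm_ge0.
have b0 : 0 < vnorm v by rewrite lt_def v0 vnorm_ge0.
rewrite -(@ler_pXn2r _ 2%N)// ?nnegrE ?addr_ge0 ?vnorm_ge0//.
rewrite -(ler_pM2l (mulr_gt0 a0 b0)) sqr_vnorm mulr_sumr.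
set a := vnorm u in a0 *; set b := vnorm v in b0 *.
apply: (@le_trans _ _ (\sum_(i < m) (b * (a + b) * u i ord0 ^+ 2 +
                                     a * (a + b) * v i ord0 ^+ 2))).
  apply: ler_sum => i _; rewrite mxE -subr_ge0.
  have := sqr_ge0 (b * u i ord0 - a * v i ord0).
  congr (0 <= _); ring.
rewrite big_split/= -!mulr_sumr -!sqr_vnorm -/a -/b.
by rewrite le_eqVlt; apply/orP; left; apply/eqP; ring.
Qed.

Lemma vnorm_le_sum m (v : 'cV[R]_m) : vnorm v <= \sum_(i < m) `|v i ord0|.
Proof.
have s0 (s : seq 'I_m) : 0 <= \sum_(i <- s) `|v i ord0| by exact: sumr_ge0.
rewrite -(@ler_pXn2r _ 2%N)// ?nnegrE ?vnorm_ge0 ?s0// sqr_vnorm.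
elim: (index_enum _) => [|i s IH]; first by rewrite !big_nil expr0n.
rewrite !big_cons sqrrD real_normK ?num_real// -addrA lerD2l.
by rewrite (le_trans IH)// lerDr mulrn_wge0// mulr_ge0.
Qed.

(** The entrywise [l^1] distance, for which rational matrices are dense and every
    norm considered below is 1-Lipschitz. *)
Definition mxdist m k (A B : 'M[R]_(m, k)) : R :=
  \sum_(i < m) \sum_(j < k) `|A i j - B i j|.

Lemma vnorm_lipschitz m (u v : 'cV[R]_m) : vnorm u <= vnorm v + mxdist u v.
Proof.
rewrite -{1}(subrK v u) addrC (le_trans (vnormD_le _ _))// lerD2l.
apply: (le_trans (vnorm_le_sum _)); apply: ler_sum => i _.
by rewrite big_ord1 !mxE.
Qed.

Lemma vnorm_mulmx_le m k (A : 'M[R]_(m, k)) (v : 'cV[R]_k) : vnorm v <= 1 ->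
  vnorm (A *m v) <= \sum_(i < m) \sum_(j < k) `|A i j|.
Proof.
move=> v1; apply: (le_trans (vnorm_le_sum _)); apply: ler_sum => i _.
rewrite mxE (le_trans (ler_norm_sum _ _ _))//; apply: ler_sum => j _.
by rewrite normrM ler_piMr// (le_trans (entry_le_vnorm _ _)).
Qed.

Lemma opnorm_has_sup m k (A : 'M[R]_(m, k)) :
  has_sup [set vnorm (A *m v) | v in [set v : 'cV[R]_k | vnorm v <= 1]].
Proof.
split; first by exists (vnorm (A *m 0)), 0 => //=; rewrite vnorm0.
exists (\sum_(i < m) \sum_(j < k) `|A i j|) => _ [v /= v1 <-].
exact: vnorm_mulmx_le.
Qed.

Lemma vnorm_mulmx_le_opnorm m k (A : 'M[R]_(m, k)) (v : 'cV[R]_k) :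
  vnorm v <= 1 -> vnorm (A *m v) <= opnorm A.
Proof. by move=> v1; apply: (sup_upper_bound (opnorm_has_sup A)); exists v. Qed.

Lemma opnorm_lipschitz m k (A B : 'M[R]_(m, k)) :
  opnorm A <= opnorm B + mxdist A B.
Proof.
apply: ge_sup => [|_ [v /= v1 <-]]; first by case: (opnorm_has_sup A).
rewrite -{1}(subrK B A) mulmxDl addrC (le_trans (vnormD_le _ _))//.
rewrite lerD ?vnorm_mulmx_le_opnorm// (le_trans (vnorm_mulmx_le _ v1))//.
by apply: ler_sum => i _; apply: ler_sum => j _; rewrite !mxE.
Qed.

Lemma entry_le_opnorm m k (A : 'M[R]_(m, k)) i j : `|A i j| <= opnorm A.
Proof.
have -> : A i j = (A *m (delta_mx j 0 : 'cV_k)) i ord0 by rewrite -colE mxE.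
apply: (le_trans (entry_le_vnorm _ _)); apply: vnorm_mulmx_le_opnorm.
apply: (le_trans (vnorm_le_sum _)); rewrite (bigD1 j)//= big1 ?addr0.
  by rewrite mxE !eqxx normr1.
by move=> l /negbTE lj; rewrite mxE lj normr0.
Qed.

Lemma opnorm_le_sum m k (A : 'M[R]_(m, k)) :
  opnorm A <= \sum_(i < m) \sum_(j < k) `|A i j|.
Proof.
apply: ge_sup => [|_ [v /= v1 <-]]; first by case: (opnorm_has_sup A).
exact: vnorm_mulmx_le.
Qed.

Lemma rat_mx_dense m k (A : 'M[R]_(m, k)) (e : R) : 0 < e ->
  exists Q : 'M[rat]_(m, k), mxdist A (map_mx ratr Q) < e.
Proof.
move=> e0; pose c : R := (m * k)%:R + 1.
have c0 : 0 < c by rewrite ltr_wpDl.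
have step i j : exists q : rat, `|A i j - ratr q| < e / c.
  have : A i j - e / c < A i j + e / c.
    by rewrite ltrD2l gtrN// divr_gt0.
  move=> /rat_in_itvoo[q]; rewrite in_itv/= => /andP[q1 q2].
  by exists q; rewrite ltr_norml; apply/andP; split; lra.
exists (\matrix_(i, j) projT1 (cid (step i j))).
apply: (@le_lt_trans _ _ (\sum_(i < m) \sum_(j < k) e / c)).
  apply: ler_sum => i _; apply: ler_sum => j _; rewrite !mxE.
  by case: cid => q /= /ltW.
rewrite !sumr_const !card_ord -mulrnA mulnC -mulr_natr -mulrA gtr_pMr//.
by rewrite mulrC ltr_pdivrMr// mul1r ltrDl.
Qed.

End MatrixNorms.

(** * Measurability *)

Section Measurability.
Context (d : measure_display) (T : measurableType d) (R : realType).

Lemma measurable_gtr (f : T -> R) (r : R) :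
  measurable_fun setT f -> measurable [set om | r < f om].
Proof.
move=> mf; rewrite [X in measurable X](_ : _ = setT `&` f @^-1` `]r, +oo[).
  exact: mf.
by apply/seteqP; split => om /=; rewrite in_itv/= andbT => // -[].
Qed.

(** The set where [f (M om)] exceeds [c] is the union, over the countably many
    rational matrices [Q], of the sets where [c + mxdist (M om) Q < f Q]. *)
Lemma measurable_lipschitz m k (f : 'M[R]_(m, k) -> R) (M : T -> 'M[R]_(m, k)) :
  (forall A B, f A <= f B + mxdist A B) ->
  (forall i j, measurable_fun setT (fun om => M om i j)) ->
  measurable_fun setT (fun om => f (M om)).
Proof.
move=> flip mM _; apply: (measurability _ (RGenOInfty.measurableE R)) => //.
move=> /= _ [_ [c ->] <-]; rewrite setTI preimage_itvoy.
rewrite [X in measurable X](_ : _ = \bigcup_(Q : 'M[rat]_(m, k))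
    [set om | mxdist (M om) (map_mx ratr Q) < f (map_mx ratr Q) - c]).
  apply: countable_bigcupT_measurable => // Q.
  rewrite [X in measurable X](_ : _ = [set om | c - f (map_mx ratr Q) <
      - mxdist (M om) (map_mx ratr Q)]); last first.
    by apply/seteqP; split => om /=; lra.
  apply: measurable_gtr; apply: measurable_funN.
  apply: measurable_sum => i; apply: measurable_sum => j.
  by apply: measurableT_comp => //; apply: measurable_funB.
have distC A B : mxdist A B = mxdist B A :> R.
  by apply: eq_bigr => i _; apply: eq_bigr => j _; rewrite distrC.
apply/seteqP; split => [om /= cf|om [Q _] /=]; last first.
  by have := flip (map_mx ratr Q) (M om); rewrite distC; lra.
have e0 : 0 < (f (M om) - c) / 2 by lra.
have [Q MQ] := rat_mx_dense (M om) e0.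
by exists Q => //=; have := flip (M om) (map_mx ratr Q); lra.
Qed.

(** Inversion is continuous away from [0], and [{0}] is measurable. *)
Lemma measurable_funV (f : T -> R) :
  measurable_fun setT f -> measurable_fun setT (fun om => (f om)^-1).
Proof.
move=> mf; apply: (@measurableT_comp _ _ _ _ _ _ (@GRing.inv R)) => //.
rewrite -(setUv [set 0]); apply/measurable_funU => //.
  exact/measurableC.
split; first exact: measurable_fun_set1.
apply: open_continuous_measurable_fun.
  exact/closed_openC/closed_eq.
by move=> r; rewrite inE/= => /eqP r0; exact: inv_continuous.
Qed.

End Measurability.

(** * Convergence and boundedness in probability of real sequences *)

Section InProbability.
Context (d : measure_display) (T : measurableType d) (R : realType).
Context (P : probability T R).
Implicit Types (X Y : nat -> T -> R) (l m : R).

Definition eventually_measurable X :=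
  \forall n \near \oo, measurable_fun setT (X n).

(** Measurability is part of the notions below: the measure of a set that is not
    measurable is unconstrained, so that even monotonicity needs it. *)
Definition tight X := eventually_measurable X /\
  forall e : R, 0 < e -> exists K : R,
    \forall n \near \oo, (P [set om | (K < `|X n om|)%R] <= e%:E)%E.

Definition cvg_prob X l := eventually_measurable X /\
  forall e eta : R, 0 < e -> 0 < eta ->
    \forall n \near \oo, (P [set om | (e < `|X n om - l|)%R] <= eta%:E)%E.

Lemma measurable_normr_gt (f : T -> R) (K : R) :
  measurable_fun setT f -> measurable [set om | K < `|f om|].
Proof. by move=> mf; apply: measurable_gtr; exact: measurableT_comp. Qed.

Lemma prob_gt_le (f g : T -> R) (K L a : R) :
  measurable_fun setT f -> measurable_fun setT g ->
  (forall om, `|g om| <= L -> `|f om| <= K) ->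
  (P [set om | (L < `|g om|)%R] <= a%:E)%E -> (P [set om | (K < `|f om|)%R] <= a%:E)%E.
Proof.
move=> mf mg gf; apply: le_trans; apply: le_measure;
  rewrite ?inE; try exact: measurable_normr_gt.
by move=> om /=; apply: contraTT; rewrite -!leNgt; exact: gf.
Qed.

(** The union bound behind all the two-variable rules: the event on the left lies
    in the union of the two events whose probabilities are bounded. *)
Lemma prob_gt_leD (f g h : T -> R) (K L1 L2 a b : R) :
  measurable_fun setT f -> measurable_fun setT g -> measurable_fun setT h ->
  (forall om, `|g om| <= L1 -> `|h om| <= L2 -> `|f om| <= K) ->
  (P [set om | (L1 < `|g om|)%R] <= a%:E)%E -> (P [set om | (L2 < `|h om|)%R] <= b%:E)%E ->
  (P [set om | (K < `|f om|)%R] <= (a + b)%:E)%E.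
Proof.
move=> mf mg mh ghf Pa Pb; have mA := measurable_normr_gt L1 mg.
have mB := measurable_normr_gt L2 mh.
rewrite EFinD; apply: le_trans (leeD Pa Pb).
apply: le_trans (measureU2 _ _ _) => //; apply: le_measure;
  rewrite ?inE; [exact: measurable_normr_gt|exact: measurableU|].
move=> om /= Kf; have [gl|] := leP `|g om| L1; last by left.
have [hl|] := leP `|h om| L2; last by right.
by move: Kf; rewrite ltNge ghf.
Qed.

Lemma tight_eq X Y : (\forall n \near \oo, X n = Y n) -> tight X -> tight Y.
Proof.
move=> XY [mX tX]; split; first by near do rewrite -(near XY _)//.
move=> e /tX[K XK]; exists K; near=> n.
by rewrite -(near XY n)//; near: n.
Unshelve. all: by end_near. Qed.

Lemma cvg_prob_eq X Y l :
  (\forall n \near \oo, X n = Y n) -> cvg_prob X l -> cvg_prob Y l.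
Proof.
move=> XY [mX cX]; split; first by near do rewrite -(near XY _)//.
move=> e eta e0 eta0; have Xe := cX _ _ e0 eta0; near=> n.
by rewrite -(near XY n)//; near: n.
Unshelve. all: by end_near. Qed.

Lemma tight_le X Y : eventually_measurable Y ->
  (\forall n \near \oo, forall om, `|Y n om| <= `|X n om|) -> tight X -> tight Y.
Proof.
move=> mY YX [mX tX]; split=> // e /tX[K XK]; exists K; near=> n.
apply: (@prob_gt_le _ (X n) K K); [by near: n..| |by near: n].
by move=> om; apply: le_trans; exact: (near YX n).
Unshelve. all: by end_near. Qed.

Lemma cvg_prob0_le X Y : eventually_measurable Y ->
  (\forall n \near \oo, forall om, `|Y n om| <= `|X n om|) ->
  cvg_prob X 0 -> cvg_prob Y 0.
Proof.
move=> mY YX [mX cX]; split=> // e eta e0 eta0.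
have Xe := cX _ _ e0 eta0; near=> n.
apply: (@prob_gt_le _ (fun om => X n om - 0) e e); last by near: n.
- by apply: measurable_funB => //; near: n.
- by apply: measurable_funB => //; near: n.
by move=> om; rewrite !subr0; apply: le_trans; exact: (near YX n).
Unshelve. all: by end_near. Qed.

Lemma eventually_measurable_norm X :
  eventually_measurable X -> eventually_measurable (fun n om => `|X n om|).
Proof. by apply: filterS => n mX; exact: measurableT_comp. Qed.

Lemma tight_subseq X (phi : nat -> nat) : phi @ \oo --> \oo ->
  tight X -> tight (fun n => X (phi n)).
Proof.
move=> phioo [mX tX]; split; first exact: (phioo _ mX).
by move=> e /tX[K XK]; exists K; exact: (phioo _ XK).
Qed.

Lemma cvg_prob_subseq X (phi : nat -> nat) l : phi @ \oo --> \oo ->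
  cvg_prob X l -> cvg_prob (fun n => X (phi n)) l.
Proof.
move=> phioo [mX cX]; split; first exact: (phioo _ mX).
by move=> e eta e0 eta0; exact: (phioo _ (cX _ _ e0 eta0)).
Qed.

Lemma tight_bounded (c : nat -> R) (K : R) :
  (\forall n \near \oo, `|c n| <= K) -> tight (fun n _ => c n).
Proof.
move=> cK; split; first by near do exact: measurable_cst.
move=> e e0; exists K; near=> n.
rewrite [X in P X](_ : _ = set0) ?measure0 ?lee_fin ?ltW//.
by apply/seteqP; split => om //=; rewrite ltNge (near cK n).
Unshelve. all: by end_near. Qed.

Lemma tight_cst l : tight (fun _ _ => l).
Proof. by apply: (@tight_bounded _ `|l|); exact: nearW. Qed.

Lemma cvg_prob_det (c : nat -> R) l : c @ \oo --> l -> cvg_prob (fun n _ => c n) l.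
Proof.
move=> cl; split; first by near do exact: measurable_cst.
move=> e eta e0 eta0; near=> n.
rewrite [X in P X](_ : _ = set0) ?measure0 ?lee_fin ?ltW//.
apply/seteqP; split => om //=; rewrite ltNge distrC.
rewrite (_ : _ <= _)//; near: n; exact: cvgr_dist_le.
Unshelve. all: by end_near. Qed.

Lemma cvg_prob_cst l : cvg_prob (fun _ _ => l) l.
Proof. by apply: cvg_prob_det; exact: cvg_cst. Qed.

Lemma cvg_prob_sub0 X l : cvg_prob X l <-> cvg_prob (fun n om => X n om - l) 0.
Proof.
split=> -[mX cX]; split.
- by near=> n; apply: measurable_funB => //; near: n; exact: mX.
- move=> e eta e0 eta0; have := cX _ _ e0 eta0.
  by apply: filterS => n; under eq_set do rewrite -[X in `|X|]subr0.
- near=> n; have -> : X n = (fun om => (X n om - l) + l).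
    by apply/funext => om; rewrite subrK.
  by apply: measurable_funD => //; near: n; exact: mX.
- move=> e eta e0 eta0; have := cX _ _ e0 eta0.
  by apply: filterS => n; under eq_set do rewrite subr0.
Unshelve. all: by end_near. Qed.

Lemma tightD X Y : tight X -> tight Y -> tight (fun n om => X n om + Y n om).
Proof.
move=> [mX tX] [mY tY]; split.
  by near=> n; apply: measurable_funD; near: n.
move=> e e0; have e20 : 0 < e / 2 by rewrite divr_gt0.
have [K XK] := tX _ e20; have [L YL] := tY _ e20; exists (K + L); near=> n.
rewrite [e]splitr; apply: (@prob_gt_leD _ (X n) (Y n) _ K L).
- by apply: measurable_funD; near: n.
- by near: n.
- by near: n.
- by move=> om XK' YL'; rewrite (le_trans (ler_normD _ _))// lerD.
- by near: n.
- by near: n.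
Unshelve. all: by end_near. Qed.

Lemma tightM X Y : tight X -> tight Y -> tight (fun n om => X n om * Y n om).
Proof.
move=> [mX tX] [mY tY]; split.
  by near=> n; apply: measurable_funM; near: n.
move=> e e0; have e20 : 0 < e / 2 by rewrite divr_gt0.
have [K XK] := tX _ e20; have [L YL] := tY _ e20; exists (K * L); near=> n.
rewrite [e]splitr; apply: (@prob_gt_leD _ (X n) (Y n) _ K L).
- by apply: measurable_funM; near: n.
- by near: n.
- by near: n.
- by move=> om XK' YL'; rewrite normrM ler_pM.
- by near: n.
- by near: n.
Unshelve. all: by end_near. Qed.

Lemma tightN X : tight X -> tight (fun n om => - X n om).
Proof.
move=> tX; apply: tight_eq (tightM (tight_cst (-1)) tX).
by apply: nearW => n; apply/funext => om; rewrite mulN1r.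
Unshelve. all: by end_near. Qed.

Lemma tight_sum (I : Type) (s : seq I) (X : I -> nat -> T -> R) :
  (forall i, tight (X i)) -> tight (fun n om => \sum_(i <- s) X i n om).
Proof.
move=> tX; elim: s => [|i s IH].
  apply: tight_eq (tight_cst 0).
  by apply: nearW => n; apply/funext => om; rewrite big_nil.
apply: tight_eq (tightD (tX i) IH).
by apply: nearW => n; apply/funext => om; rewrite big_cons.
Unshelve. all: by end_near. Qed.

Lemma cvg_prob_tight X l : cvg_prob X l -> tight X.
Proof.
move=> [mX cX]; split=> // e e0; exists (`|l| + 1).
have := cX 1 e ltr01 e0; apply: filterS2 mX => n mX.
apply: prob_gt_le => //; first exact: measurable_funB.
move=> om; have := ler_normD (X n om - l) l; rewrite subrK; lra.
Qed.

Lemma cvg_probD X Y l m : cvg_prob X l -> cvg_prob Y m ->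
  cvg_prob (fun n om => X n om + Y n om) (l + m).
Proof.
move=> [mX cX] [mY cY]; split.
  by near=> n; apply: measurable_funD; near: n.
move=> e eta e0 eta0; have e20 : 0 < e / 2 by rewrite divr_gt0.
have eta20 : 0 < eta / 2 by rewrite divr_gt0.
have Xe := cX _ _ e20 eta20; have Ye := cY _ _ e20 eta20; near=> n.
have mXn : measurable_fun setT (X n) by near: n.
have mYn : measurable_fun setT (Y n) by near: n.
rewrite [eta]splitr; apply: (@prob_gt_leD _ (fun om => X n om - l)
  (fun om => Y n om - m) _ (e / 2) (e / 2)); do ?exact: measurable_funB.
- by apply: measurable_funB => //; exact: measurable_funD.
- move=> om; have := ler_normD (X n om - l) (Y n om - m).
  by rewrite addrACA -opprD; lra.
- by near: n.
- by near: n.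
Unshelve. all: by end_near. Qed.

(** Off an event of small probability [X] is at most some [K], and then
    [|Y| <= e / (|K| + 1)] forces [|X Y| <= e]. *)
Lemma tight_mul_cvg0 X Y : tight X -> cvg_prob Y 0 ->
  cvg_prob (fun n om => X n om * Y n om) 0.
Proof.
move=> [mX tX] [mY cY]; split.
  by near=> n; apply: measurable_funM; near: n.
move=> e eta e0 eta0; have eta20 : 0 < eta / 2 by rewrite divr_gt0.
have [K XK] := tX _ eta20; have K0 : 0 < `|K| + 1 by rewrite ltr_wpDl.
have eK0 : 0 < e / (`|K| + 1) by rewrite divr_gt0.
have Ye := cY _ _ eK0 eta20; near=> n.
have mXn : measurable_fun setT (X n) by near: n.
have mYn : measurable_fun setT (Y n) by near: n.
rewrite [eta]splitr; apply: (@prob_gt_leD _ (X n)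
  (fun om => Y n om - 0) _ K (e / (`|K| + 1))) => //.
- by apply: measurable_funB => //; exact: measurable_funM.
- exact: measurable_funB.
- move=> om XK'; rewrite !subr0 => YK; rewrite normrM.
  rewrite -[leRHS](divfK (lt0r_neq0 K0)) mulrC ler_pM//.
  by rewrite (le_trans XK')// (le_trans (ler_norm _))// lerDl.
- by near: n.
- by near: n.
Unshelve. all: by end_near. Qed.

(** [X Y - l m = Y (X - l) + l (Y - m)]. *)
Lemma cvg_probM X Y l m : cvg_prob X l -> cvg_prob Y m ->
  cvg_prob (fun n om => X n om * Y n om) (l * m).
Proof.
move=> cX cY; apply/cvg_prob_sub0; rewrite -[0]addr0.
have /cvg_prob_sub0 cX0 := cX; have /cvg_prob_sub0 cY0 := cY.
apply: cvg_prob_eq (cvg_probD (tight_mul_cvg0 (cvg_prob_tight cY) cX0)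
                              (tight_mul_cvg0 (tight_cst l) cY0)).
by apply: nearW => n; apply/funext => om; ring.
Unshelve. all: by end_near. Qed.

Lemma cvg_prob_sum (I : eqType) (s : seq I) (X : I -> nat -> T -> R) (l : I -> R) :
  (forall i, i \in s -> cvg_prob (X i) (l i)) ->
  cvg_prob (fun n om => \sum_(i <- s) X i n om) (\sum_(i <- s) l i).
Proof.
elim: s => [_|i s IH cX].
  rewrite big_nil; apply: cvg_prob_eq (cvg_prob_cst 0).
  by apply: nearW => n; apply/funext => om; rewrite big_nil.
rewrite big_cons; apply: cvg_prob_eq (cvg_probD (cX i _) (IH _)).
- by apply: nearW => n; apply/funext => om; rewrite big_cons.
- exact: mem_head.
- by move=> j js; apply: cX; rewrite inE js orbT.
Qed.

Lemma cvg_probV X l : l != 0 -> cvg_prob X l ->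
  cvg_prob (fun n om => (X n om)^-1) l^-1.
Proof.
move=> l0 [mX cX]; split.
  by near=> n; apply: measurable_funV; near: n.
have nl0 : 0 < `|l| by rewrite normr_gt0.
(* within [`|l| / 2] of [l], inversion is Lipschitz with constant [2 / l ^ 2] *)
move=> e eta e0 eta0; pose del := Num.min (`|l| / 2) (e * (`|l| * (`|l| / 2))).
have del0 : 0 < del by rewrite lt_min !(mulr_gt0,divr_gt0).
have Xe := cX _ _ del0 eta0; near=> n.
have mXn : measurable_fun setT (X n) by near: n.
apply: (@prob_gt_le _ (fun om => X n om - l) _ del); last by near: n.
- by apply: measurable_funB => //; exact: measurable_funV.
- exact: measurable_funB.
move=> om; rewrite le_min => /andP[X1 X2].
have Xl : `|l| / 2 <= `|X n om|.
  by have := ler_normB (X n om) (X n om - l); rewrite opprB addrC subrK; lra.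
have nX0 : 0 < `|X n om| by rewrite (lt_le_trans _ Xl)// divr_gt0.
have X0 : X n om != 0 by rewrite -normr_gt0.
have -> : (X n om)^-1 - l^-1 = (l - X n om) / (l * X n om).
  by field; rewrite l0 X0.
rewrite normrM normfV normrM distrC ler_pdivrMr ?mulr_gt0//.
by rewrite (le_trans X2)// ler_pM2l// ler_pM2l.
Unshelve. all: by end_near. Qed.

Lemma bigO_pP (V : Type) (nrm : V -> R) (M : nat -> T -> V) (c : nat -> R) :
  (forall v, 0 <= nrm v) -> (\forall n \near \oo, 0 < c n) ->
  eventually_measurable (fun n om => nrm (M n om)) ->
  bigO_p P nrm M c <-> tight (fun n om => nrm (M n om) / c n).
Proof.
move=> nrm0 c0 mM.
have normE : \forall n \near \oo, forall om : T,
    `|nrm (M n om) / c n| = nrm (M n om) / c n.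
  by apply: filterS c0 => n c0 om; rewrite ger0_norm// divr_ge0// ltW.
split=> [MO|[_ tM] e /tM[K MK]]; last first.
  exists K; near=> n; under eq_set do rewrite -(near normE n)//.
  by near: n.
split; first by apply: filterS mM => n mM; exact: measurable_funM.
move=> e /MO[K MK]; exists K; near=> n.
by under eq_set do rewrite (near normE n)//; near: n.
Unshelve. all: by end_near. Qed.

Lemma littleo_pP (V : Type) (nrm : V -> R) (M : nat -> T -> V) :
  (forall v, 0 <= nrm v) -> eventually_measurable (fun n om => nrm (M n om)) ->
  littleo_p P nrm M (fun=> 1) <-> cvg_prob (fun n om => nrm (M n om)) 0.
Proof.
move=> nrm0 mM.
have normE n e : [set om | e < `|nrm (M n om) - 0|] = [set om | e < nrm (M n om) / 1].
  by apply/seteqP; split => om /=; rewrite subr0 divr1 ger0_norm.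
have finM e : \forall n \near \oo, P [set om | e < nrm (M n om) / 1] \is a fin_num.
  apply: filterS mM => n mM; rewrite fin_num_measure//.
  by apply: measurable_gtr; exact: measurable_funM.
split=> [cX|[_ cX] e e0].
  split=> // e eta e0 eta0; have /fine_cvgP[fX cfX] := cX _ e0.
  move/cvgr0Pnorm_le : cfX => /(_ _ eta0); apply: filterS2 fX => n fX /=.
  by rewrite normE ger0_norm ?fine_ge0// -lee_fin fineK.
apply/fine_cvgP; split; first exact: finM.
apply/cvgr0Pnorm_le => eta eta0; have := cX _ _ e0 eta0.
apply: filterS2 (finM e) => n fX /=.
by rewrite normE ger0_norm ?fine_ge0// -lee_fin fineK.
Qed.

(** Markov's inequality, at the level [(|K| + 1) / e]. *)
Lemma tight_of_mean X (K : R) : (forall n, measurable_fun setT (X n)) ->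
  (forall n, (\int[P]_om (`|X n om|%R)%:E <= K%:E)%E) -> tight X.
Proof.
move=> mX XK; split; first by near do exact: mX.
move=> e e0; have K0 : 0 < `|K| + 1 by rewrite ltr_wpDl.
pose a := (`|K| + 1) / e; have a0 : 0 < a by rewrite divr_gt0.
exists a; near=> n; rewrite -(@lee_pmul2l _ a%:E)//.
have mXn : measurable_fun setT (EFin \o X n) by apply/measurable_EFinP.
apply: (@le_trans _ _ (\int[P]_om `|(EFin \o X n) om|)%E).
  apply: le_trans (le_integral_abse P measurableT mXn a0).
  rewrite lee_pmul2l//; apply: le_measure; rewrite ?inE.
  - exact: measurable_normr_gt.
  - rewrite [X in measurable X](_ : _ = setT `&` (fun om => `|X n om|) @^-1` `[a, +oo[).
      exact: measurableT_comp.
    by apply/seteqP; split => om /=; rewrite in_itv/= andbT lee_fin.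
  - by move=> om /= /ltW; rewrite lee_fin; split.
rewrite (le_trans (XK n))// -EFinM lee_fin divfK ?gt_eqF//.
by rewrite (le_trans (ler_norm _))// lerDl.
Unshelve. all: by end_near. Qed.

Lemma tight_mean (Z : nat -> T -> R) (K : R) :
  (forall t, measurable_fun setT (Z t)) ->
  (forall t, (\int[P]_om (`|Z t om|%R)%:E <= K%:E)%E) ->
  tight (fun n om => n%:R^-1 * \sum_(1 <= t < n.+1) Z t om).
Proof.
move=> mZ ZK; apply: (@tight_of_mean _ K) => n.
  by apply: measurable_funM => //; exact: measurable_sum.
have mnZ t : measurable_fun setT (fun om => `|Z t om|) by exact: measurableT_comp.
have n0 : (0 : R) <= n%:R^-1 by rewrite invr_ge0.
apply: (@le_trans _ _
    (\int[P]_om ((n%:R^-1)%R%:E * (\sum_(1 <= t < n.+1) (`|Z t om|%R)%:E)%E))%E).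
  apply: ge0_le_integral => //.
  - by apply/measurable_EFinP; apply: measurableT_comp => //;
      apply: measurable_funM => //; exact: measurable_sum.
  - apply: measurable_funeM; apply: emeasurable_sum => t.
    exact/measurable_EFinP.
  - move=> om _; rewrite sumEFin -EFinM lee_fin normrM ger0_norm//.
    by rewrite ler_wpM2l// ler_norm_sum.
rewrite ge0_integralZl ?lee_fin//; last 2 first.
  - by apply: emeasurable_sum => t; exact/measurable_EFinP.
  - by move=> om _; apply: sume_ge0 => t _; rewrite lee_fin.
rewrite ge0_integral_sum//; last first.
  by move=> t; exact/measurable_EFinP.
have K0 : 0 <= K.
  by rewrite -lee_fin (le_trans _ (ZK 0%N))// integral_ge0// => om _; rewrite lee_fin.
apply: (@le_trans _ _ ((n%:R^-1)%R%:E * \sum_(1 <= t < n.+1) K%:E)%E).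
  by rewrite lee_wpmul2l ?lee_fin//; apply: lee_sum => t _; exact: ZK.
rewrite sumEFin -EFinM lee_fin sumr_const_nat subSS subn0 -[K *+ n]mulr_natr mulrCA.
by rewrite ler_piMr//; case: n {n0} => [|n]; rewrite ?mulr0// mulVf.
Qed.

End InProbability.

(** * From matrices to their entries *)

(** The Euclidean and the operator norm are treated together through the
    properties they share: [nrm] is Lipschitz in the entries and lies between
    each [|A i j|] and the sum of all of them. *)
Section Entrywise.
Context (d : measure_display) (T : measurableType d) (R : realType).
Context (P : probability T R) (m k : nat) (nrm : 'M[R]_(m, k) -> R).
Context (nrm_lip : forall A B, nrm A <= nrm B + mxdist A B).
Context (nrm_ge0 : forall A, 0 <= nrm A).
Implicit Types (M : nat -> T -> 'M[R]_(m, k)) (c : nat -> R) (L : 'M[R]_(m, k)).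

Lemma eventually_measurable_nrm M :
  (forall i j, eventually_measurable (fun n om => M n om i j)) ->
  eventually_measurable (fun n om => nrm (M n om)).
Proof.
move=> mM.
have mM' : \forall n \near \oo, forall i j,
    measurable_fun setT (fun om => M n om i j).
  by apply: filter_forall => i; apply: filter_forall => j; exact: mM.
by apply: filterS mM' => n mMn; exact: measurable_lipschitz.
Qed.

Lemma bigO_p_tight_entry M c i j : (forall A : 'M[R]_(m, k), `|A i j| <= nrm A) ->
  (forall n i j, measurable_fun setT (fun om => M n om i j)) ->
  (\forall n \near \oo, 0 < c n) ->
  bigO_p P nrm M c -> tight P (fun n om => M n om i j / c n).
Proof.
move=> entry_le mM c0 /(bigO_pP _ nrm_ge0 c0) MO.
apply: tight_le (MO _).
- by apply: nearW => n; exact: measurable_funM.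
- near=> n => om; have cn0 : 0 < c n by near: n.
  by rewrite !normrM ler_wpM2r// (le_trans (entry_le _))// ler_norm.
- by apply: eventually_measurable_nrm => i' j'; apply: nearW => n; exact: mM.
Unshelve. all: by end_near. Qed.

Lemma littleo_p_cvg_entry M L i j : (forall A : 'M[R]_(m, k), `|A i j| <= nrm A) ->
  (forall n i j, measurable_fun setT (fun om => M n om i j)) ->
  littleo_p P nrm (fun n om => M n om - L) (fun=> 1) ->
  cvg_prob P (fun n om => M n om i j) (L i j).
Proof.
move=> entry_le mM.
have mML i' j' : eventually_measurable (fun n om => (M n om - L) i' j').
  apply: nearW => n; under eq_fun do rewrite mxE.
  by apply: measurable_funD.
move=> /(littleo_pP _ nrm_ge0 (eventually_measurable_nrm mML)) Mo.
apply/cvg_prob_sub0; apply: cvg_prob0_le Mo.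
  by apply: nearW => n; apply: measurable_funB.
apply: nearW => n om; rewrite (le_trans _ (ler_norm _))//.
by rewrite (le_trans _ (entry_le _))// !mxE.
Qed.

Context (nrm_le_sum : forall A : 'M[R]_(m, k), nrm A <= \sum_i \sum_j `|A i j|).

Lemma tight_entry_bigO_p M c : (\forall n \near \oo, 0 < c n) ->
  (forall i j, tight P (fun n om => M n om i j / c n)) -> bigO_p P nrm M c.
Proof.
move=> c0 tM.
have mM : eventually_measurable (fun n om => nrm (M n om)).
  apply: eventually_measurable_nrm => i j.
  (* only the rescaled entries are known to be measurable: rescale back *)
  near=> n; have cn0 : c n != 0 by rewrite gt_eqF//; near: n.
  have -> : (fun om => M n om i j) = (fun om => M n om i j / c n * c n).
    by apply/funext => om; rewrite divfK.
  by apply: measurable_funM => //; near: n; exact: (tM i j).1.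
apply/bigO_pP => //.
have tS : tight P (fun n om => \sum_i \sum_j `|M n om i j / c n|).
  apply: tight_sum => i; apply: tight_sum => j.
  apply: tight_le (tM i j); last by apply: nearW => n om; rewrite normr_id.
  exact: eventually_measurable_norm (tM i j).1.
apply: tight_le tS.
  by apply: filterS mM => n mMn; exact: measurable_funM.
near=> n => om; have cn0 : 0 < c n by near: n.
apply: le_trans (ler_norm _); rewrite ger0_norm ?divr_ge0 ?(ltW cn0)//.
rewrite ler_pdivrMr// mulr_suml (le_trans (nrm_le_sum _))//.
apply: ler_sum => i _; rewrite mulr_suml; apply: ler_sum => j _.
by rewrite normrM normfV (gtr0_norm cn0) divfK ?gt_eqF.
Unshelve. all: by end_near. Qed.

Lemma cvg_entry_littleo_p M L :
  (forall i j, cvg_prob P (fun n om => M n om i j) (L i j)) ->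
  littleo_p P nrm (fun n om => M n om - L) (fun=> 1).
Proof.
move=> cM.
have cML i j : cvg_prob P (fun n om => (M n om - L) i j) 0.
  have /cvg_prob_sub0 := cM i j; apply: cvg_prob_eq.
  by apply: nearW => n; apply/funext => om; rewrite !mxE.
have mML := eventually_measurable_nrm (fun i j => (cML i j).1).
apply/littleo_pP => //.
have cS : cvg_prob P (fun n om => \sum_i \sum_j `|(M n om - L) i j|) 0.
  rewrite [X in cvg_prob _ _ X](_ : 0 = \sum_(i < m) \sum_(j < k) (0 : R)); last first.
    by rewrite big1// => i _; rewrite big1.
  apply: cvg_prob_sum => i _; apply: cvg_prob_sum => j _.
  apply: cvg_prob0_le (cML i j); last by apply: nearW => n om; rewrite normr_id.
  exact: eventually_measurable_norm (cML i j).1.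
apply: cvg_prob0_le cS => //.
by apply: nearW => n om; rewrite !ger0_norm ?sumr_ge0// => i _; exact: sumr_ge0.
Qed.

End Entrywise.

(** * Algebra of the estimators *)

Section EstimatorAlgebra.
Context (T : Type) (R : realType) (w h N : nat).
Context (x : int -> T -> R) (y eps : int -> T -> 'cV[R]_w) (beta : 'cV[R]_w).
Context (model : forall (t : int) (om : T),
  y (t + h%:Z) om = x t om *: beta + eps t om).
Implicit Types (i j : 'I_w) (om : T).

Definition score_mean i om : R :=
  N%:R^-1 * \sum_(1 <= t < N.+1) x t%:Z om * eps t%:Z om i 0.

(** The error [beta_hat - beta], except when [Rhat = 0]: it is then [0], which
    is as good, since [x] vanishes on the whole training set. *)
Definition beta_err i om : R := (Rhat N x om)^-1 * score_mean i om.

Lemma Rhat_eq0 om : Rhat N x om = 0 ->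
  forall t, (1 <= t < N.+1)%N -> x t%:Z om = 0.
Proof.
move=> /eqP; rewrite mulf_eq0 invr_eq0 pnatr_eq0 => /orP[/eqP -> t|].
  by case: t.
rewrite psumr_eq0 => [/allP x0 t tN|t _]; last exact: sqr_ge0.
have /x0 : t \in index_iota 1 N.+1 by rewrite mem_index_iota.
by rewrite /= sqrf_eq0 => /eqP.
Qed.

Lemma beta_hat_beta_err om : Rhat N x om != 0 ->
  forall i, beta_hat h N x y om i 0 = beta i 0 + beta_err i om.
Proof.
move=> R0 i; rewrite /beta_hat !mxE summxE.
have -> : \sum_(1 <= t < N.+1) (x t%:Z om *: y (t%:Z + h%:Z) om) i 0 =
    (\sum_(1 <= t < N.+1) x t%:Z om ^+ 2) * beta i 0 +
    \sum_(1 <= t < N.+1) x t%:Z om * eps t%:Z om i 0.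
  by rewrite mulr_suml -big_split; apply: eq_bigr => t _ /=; rewrite model !mxE; ring.
by rewrite mulrDr mulrDr mulrA mulrA -/(score_mean i om) -(mulrA _ N%:R^-1) mulVf// mul1r.
Qed.

(** When [Rhat = 0], [beta_hat] is the junk value [0], but it only enters through
    its product with [x t = 0]. *)
Lemma eps_hatE t om i : (1 <= t < N.+1)%N ->
  eps_hat h N x y t%:Z om i 0 = eps t%:Z om i 0 - x t%:Z om * beta_err i om.
Proof.
move=> tN; have entryE (b : 'cV[R]_w) :
    (x t om *: beta + eps t om - x t om *: b) i 0 =
    x t om * beta i 0 + eps t om i 0 - x t om * b i 0 by rewrite !mxE.
rewrite /eps_hat model entryE.
have [R0|R0] := eqVneq (Rhat N x om) 0.
  by rewrite (Rhat_eq0 R0 tN) !mul0r !subr0 add0r.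
by rewrite beta_hat_beta_err//; ring.
Qed.

(** The normal equation of least squares; when [Rhat = 0] it holds because
    [score_mean] is then [0] as well. *)
Lemma Rhat_beta_err i om : Rhat N x om * beta_err i om = score_mean i om.
Proof.
have [R0|R0] := eqVneq (Rhat N x om) 0; last by rewrite mulVKf.
rewrite R0 mul0r /score_mean big_nat big1 ?mulr0// => t tN.
by rewrite (Rhat_eq0 R0 tN) mul0r.
Qed.

Lemma sum_mulmx_trE (r s : nat) (u v : nat -> 'cV[R]_w) i j :
  (\sum_(r <= t < s) u t *m (v t)^T) i j = \sum_(r <= t < s) u t i 0 * v t j 0.
Proof.
by rewrite summxE; apply: eq_bigr => t _; rewrite mxE big_ord1 !mxE.
Qed.

(** Of the three corrections created by replacing [eps] with [eps_hat], two
    cancel by the normal equation [Rhat_beta_err]. *)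
Lemma MI_hatE om i j : MI_hat h N x y om i j =
  N%:R^-1 * (\sum_(1 <= t < N.+1) eps t%:Z om *m (eps t%:Z om)^T) i j
  - score_mean i om * beta_err j om.
Proof.
rewrite mxE !sum_mulmx_trE.
under eq_big_nat => t tN do rewrite !eps_hatE//.
transitivity (N%:R^-1 * (\sum_(1 <= t < N.+1) eps t%:Z om i 0 * eps t%:Z om j 0)
  - beta_err j om * score_mean i om - beta_err i om * score_mean j om
  + beta_err i om * (beta_err j om * Rhat N x om)).
  rewrite /score_mean /Rhat !(mulrCA _ N%:R^-1) -!mulrBr -mulrDr; congr (_ * _).
  rewrite !mulr_sumr -!sumrB -big_split.
  by apply: eq_bigr => t _ /=; ring.
rewrite -!(Rhat_beta_err) /Rhat; ring.
Qed.

(** The four products of the expansion, arranged so that each correction is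
    explicitly a multiple of [beta_err]. *)
Lemma Chs_hatE s om i j : Chs_hat h N x y s om i j =
  (N - s)%:R^-1 * (\sum_(1 <= t < (N - s).+1) (x t%:Z om *: eps t%:Z om) *m
      (x (t%:Z + s%:Z) om *: eps (t%:Z + s%:Z) om)^T) i j
  - beta_err j om * ((N - s)%:R^-1 * \sum_(1 <= t < (N - s).+1)
      x t%:Z om * x (t%:Z + s%:Z) om * x (t%:Z + s%:Z) om * eps t%:Z om i 0)
  - beta_err i om * ((N - s)%:R^-1 * \sum_(1 <= t < (N - s).+1)
      x t%:Z om * x t%:Z om * x (t%:Z + s%:Z) om * eps (t%:Z + s%:Z) om j 0)
  + beta_err i om * (beta_err j om * ((N - s)%:R^-1 *
      \sum_(1 <= t < (N - s).+1)
        x t%:Z om * x t%:Z om * x (t%:Z + s%:Z) om * x (t%:Z + s%:Z) om)).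
Proof.
rewrite mxE sum_mulmx_trE !(mulrCA _ (N - s)%:R^-1) -!mulrBr -mulrDr.
congr (_ * _); rewrite summxE !mulr_sumr -!sumrB -big_split.
have entryE (a : R) (u v : 'cV[R]_w) :
    (a *: (u *m v^T)) i j = a * (u i 0 * v j 0) by rewrite !mxE big_ord1 !mxE.
have prodE (a1 a2 e1 e2 b1 b2 : R) :
    a1 * a2 * ((e1 - a1 * b1) * (e2 - a2 * b2)) =
    a1 * e1 * (a2 * e2) - b2 * (a1 * a2 * a2 * e1) - b1 * (a1 * a1 * a2 * e2)
    + b1 * (b2 * (a1 * a1 * a2 * a2)) by ring.
apply: eq_big_nat => t tN; rewrite entryE.
have t1 : (1 <= t < N.+1)%N by lia.
have ts1 : (1 <= t + s < N.+1)%N by lia.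
by rewrite -PoszD (eps_hatE _ _ t1) (eps_hatE _ _ ts1) !mxE prodE.
Qed.

End EstimatorAlgebra.

(** * Moments and rates *)

Section Moments.
Context (d : measure_display) (T : measurableType d) (R : realType).
Context (P : probability T R).

(** AM-GM applied twice, with a generous constant. *)
Lemma normr_mul4_le (a b c e : R) :
  `|a * b * c * e| <= a ^+ 4 + b ^+ 4 + c ^+ 4 + e ^+ 4.
Proof.
have amgm (u v : R) : `|u * v| <= (u ^+ 2 + v ^+ 2) / 2.
  have := sqr_ge0 (u - v); have := sqr_ge0 (u + v).
  by rewrite ler_norml !expr2 => ? ?; apply/andP; split; lra.
have amgm2 (u v : R) : (u * v) ^+ 2 <= (u ^+ 4 + v ^+ 4) / 2.
  by rewrite exprMn (exprM u 2 2) (exprM v 2 2) (le_trans (ler_norm _)).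
have ab := amgm2 a b; have ce := amgm2 c e; have abce := amgm (a * b) (c * e).
have p4 (u : R) : 0 <= u ^+ 4 by rewrite (exprM u 2 2) sqr_ge0.
have := (p4 a, p4 b, p4 c, p4 e) => -[[[? ?] ?] ?].
by rewrite -(mulrA (a * b)) (le_trans abce)//; lra.
Qed.

Lemma mean_normr_mul4 (f g u v : T -> R) (A : R) :
  measurable_fun setT f -> measurable_fun setT g ->
  measurable_fun setT u -> measurable_fun setT v ->
  (\int[P]_om (f om ^+ 4)%:E <= A%:E)%E -> (\int[P]_om (g om ^+ 4)%:E <= A%:E)%E ->
  (\int[P]_om (u om ^+ 4)%:E <= A%:E)%E -> (\int[P]_om (v om ^+ 4)%:E <= A%:E)%E ->
  (\int[P]_om (`|f om * g om * u om * v om|%R)%:E <= (A + A + A + A)%:E)%E.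
Proof.
move=> mf mg mu mv fA gA uA vA.
have p4 (r : R) : 0 <= r ^+ 4 by rewrite (exprM r 2 2) sqr_ge0.
have mp4 (k : T -> R) : measurable_fun setT k ->
    measurable_fun setT (fun om => (k om ^+ 4)%:E).
  by move=> mk; apply/measurable_EFinP; exact: measurable_funX.
apply: (@le_trans _ _ (\int[P]_om ((f om ^+ 4)%:E + (g om ^+ 4)%:E +
    (u om ^+ 4)%:E + (v om ^+ 4)%:E))%E).
  apply: ge0_le_integral => //.
  - apply/measurable_EFinP; apply: measurableT_comp => //.
    by do 3 apply: measurable_funM => //.
  - by do 3 (apply: emeasurable_funD; last exact: mp4); exact: mp4.
  - by move=> om _; rewrite -!EFinD lee_fin normr_mul4_le.
do 3 (rewrite ge0_integralD//; last 4 first;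
  [by move=> om _; rewrite -?EFinD lee_fin ?addr_ge0 ?p4
  |by do ?[apply: emeasurable_funD]; exact: mp4
  |by move=> om _; rewrite lee_fin p4|exact: mp4|]).
by rewrite !EFinD !leeD.
Qed.

Lemma Lfun_measurable (p : \bar R) (f : T -> R) :
  f \in Lfun P p -> measurable_fun setT f.
Proof. by move=> /andP[/[!inE]]. Qed.

(** Both suprema are nonnegative, so each is at most their finite sum; the index
    [i0] excludes an empty family, whose supremum is [-oo]. *)
Lemma expectation_sup_bound (I : Type) (f g : I -> T -> R) (i0 : I) :
  (forall i om, 0 <= f i om) -> (forall i om, 0 <= g i om) ->
  (ereal_sup (range (fun i => 'E_P[f i])) +
   ereal_sup (range (fun i => 'E_P[g i])) < +oo)%E ->
  exists A : R, forall i, ('E_P[f i] <= A%:E)%E /\ ('E_P[g i] <= A%:E)%E.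
Proof.
move=> f0 g0; set a := ereal_sup _; set b := ereal_sup _ => ab.
have fa i : ('E_P[f i] <= a)%E by apply: ereal_sup_ubound; exists i.
have gb i : ('E_P[g i] <= b)%E by apply: ereal_sup_ubound; exists i.
have a0 : (0 <= a)%E by apply: le_trans (fa i0); exact: expectation_ge0.
have b0 : (0 <= b)%E by apply: le_trans (gb i0); exact: expectation_ge0.
have abE : (fine (a + b))%:E = (a + b)%E.
  by rewrite fineK// ge0_fin_numE// adde_ge0.
exists (fine (a + b)) => i; rewrite abE; split.
  by rewrite (le_trans (fa i))// leeDl.
by rewrite (le_trans (gb i))// leeDr.
Qed.

End Moments.

Section Rates.
Context (R : realType).

Lemma cvg_sqrtV : (Num.sqrt n%:R)^-1 @[n --> \oo] --> (0 : R).
Proof.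
apply/cvgr0Pnorm_le => e e0; near=> n.
have n1 : e^-1 ^+ 2 <= n%:R by near: n; exact: nbhs_infty_ger.
have n2 : e^-1 <= Num.sqrt n%:R.
  by rewrite -(ger0_norm (ltW _ : 0 <= e^-1)) ?invr_gt0// -sqrtr_sqr ler_wsqrtr.
by rewrite ger0_norm ?invr_ge0 ?sqrtr_ge0// invf_ple// posrE// (lt_le_trans _ n2)// invr_gt0.
Unshelve. all: by end_near. Qed.

(** Since [n <= (h + 1) (n - h)] as soon as [h < n], changing the sample size
    from [n] to [n - h] does not change rates. *)
Lemma sqrt_ratio_bounded (h : nat) :
  \forall n \near \oo,
    `|Num.sqrt n%:R / Num.sqrt (n - h)%:R : R| <= Num.sqrt h.+1%:R.
Proof.
near=> n; have hn : (h < n)%N by near: n; exact: nbhs_infty_gt.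
have N0 : (0 : R) < Num.sqrt (n - h)%:R by rewrite sqrtr_gt0 ltr0n subn_gt0.
rewrite ger0_norm ?divr_ge0 ?sqrtr_ge0// ler_pdivrMr// -sqrtrM// ler_wsqrtr//.
by rewrite -natrM ler_nat; nia.
Unshelve. all: by end_near. Qed.

End Rates.

(** * Limits of the estimators *)

(** The context keeps what the limit theorems use of the processes; sample sizes
    in [Rhat_cvg] and [score_tight] are shifted from [n] to [n - h] by passing to
    a subsequence. *)
Section Asymptotics.
Context (d : measure_display) (T : measurableType d) (R : realType).
Context (P : probability T R) (h w : nat).
Context (x : int -> T -> R) (y eps : int -> T -> 'cV[R]_w) (beta : 'cV[R]_w).
Context (model : forall (t : int) (om : T),
  y (t + h%:Z) om = x t om *: beta + eps t om).
Context (mx : forall t, measurable_fun setT (x t)).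
Context (meps : forall t i, measurable_fun setT (fun om => eps t om i 0)).
Context (r : R) (r_neq0 : r != 0).
Context (Rhat_cvg : cvg_prob P (fun n => Rhat n x) r).
Context (score_tight : forall i, tight P (fun n om =>
  (Num.sqrt n%:R)^-1 * \sum_(1 <= t < n.+1) x t%:Z om * eps t%:Z om i 0)).
Implicit Types i j : 'I_w.

(** [1 / n] is split into two factors [1 / sqrt n]; one normalizes the score, the
    other drives the convergence to [0]. *)
Lemma score_mean_sqrt n i om : score_mean n x eps i om =
  (Num.sqrt n%:R)^-1 *
    ((Num.sqrt n%:R)^-1 * \sum_(1 <= t < n.+1) x t%:Z om * eps t%:Z om i 0).
Proof. by rewrite mulrA -invfM -expr2 sqr_sqrtr. Qed.

Lemma beta_err_cvg0 i : cvg_prob P (fun n => beta_err n x eps i) 0.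
Proof.
have sm0 : cvg_prob P (fun n => score_mean n x eps i) 0.
  apply: cvg_prob_eq (tight_mul_cvg0 (score_tight i) (cvg_prob_det P (@cvg_sqrtV R))).
  by apply: nearW => n; apply/funext => om; rewrite score_mean_sqrt mulrC.
by have := cvg_probM (cvg_probV r_neq0 Rhat_cvg) sm0; rewrite mulr0.
Qed.

(** The correction [q_i b_j], scaled by [sqrt n], is [sqrt n / sqrt N] times the
    tight score [sqrt N q_i] times [b_j]. *)
Lemma MI_hat_tight (L : 'M[R]_w) i j :
  tight P (fun n om => (n%:R^-1 * (\sum_(1 <= t < n.+1)
    eps t%:Z om *m (eps t%:Z om)^T) i j - L i j) / (Num.sqrt n%:R)^-1) ->
  tight P (fun n om =>
    (MI_hat h (n - h) x y om - L) i j / (Num.sqrt n%:R)^-1).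
Proof.
move=> /(tight_subseq (cvg_subnr h)) tS.
have ratio := tight_bounded P (sqrt_ratio_bounded R h).
have tG := tight_subseq (cvg_subnr h)
  (tightM (score_tight i) (cvg_prob_tight (beta_err_cvg0 j))).
apply: tight_eq (tightM ratio (tightD tS (tightN tG))).
near=> n; apply/funext => om.
have hn : (h < n)%N by near: n; exact: nbhs_infty_gt.
have N0 : Num.sqrt (n - h)%:R != 0 :> R.
  by rewrite gt_eqF// sqrtr_gt0 ltr0n subn_gt0.
rewrite mxE [in X in _ = (_ + X) / _]mxE (MI_hatE _ model) score_mean_sqrt !invrK.
set s := Num.sqrt (n - h)%:R in N0 *; set a := _^-1 * (\sum_(_ <= _ < _) _ *m _) i j.
by field.
Unshelve. all: by end_near. Qed.

Context (A : R).
Context (x_moment4 : forall t, (\int[P]_om (x t om ^+ 4)%:E <= A%:E)%E).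
Context (eps_moment4 : forall t i, (\int[P]_om (eps t om i 0 ^+ 4)%:E <= A%:E)%E).

Lemma Chs_hat_cvg (C : 'M[R]_w) s :
  (forall i j, cvg_prob P (fun n om => n%:R^-1 * (\sum_(1 <= t < n.+1)
     (x t%:Z om *: eps t%:Z om) *m
     (x (t%:Z + s%:Z) om *: eps (t%:Z + s%:Z) om)^T) i j) (C i j)) ->
  forall i j, cvg_prob P (fun n om => Chs_hat h (n - h) x y s om i j) (C i j).
Proof.
move=> cC i j.
have sub_oo : (n - h - s)%N @[n --> \oo] --> \oo.
  by under eq_fun do rewrite -subnDA; exact: cvg_subnr.
have main := cvg_prob_subseq sub_oo (cC i j).
have b0 k := cvg_prob_subseq (cvg_subnr h) (beta_err_cvg0 k).
have avg (f g u v : int -> T -> R) :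
    (forall t, measurable_fun setT (f t)) -> (forall t, measurable_fun setT (g t)) ->
    (forall t, measurable_fun setT (u t)) -> (forall t, measurable_fun setT (v t)) ->
    (forall t, (\int[P]_om (f t om ^+ 4)%:E <= A%:E)%E) ->
    (forall t, (\int[P]_om (g t om ^+ 4)%:E <= A%:E)%E) ->
    (forall t, (\int[P]_om (u t om ^+ 4)%:E <= A%:E)%E) ->
    (forall t, (\int[P]_om (v t om ^+ 4)%:E <= A%:E)%E) ->
    tight P (fun n om => (n - h - s)%:R^-1 * \sum_(1 <= t < (n - h - s).+1)
      f t%:Z om * g t%:Z om * u t%:Z om * v t%:Z om).
  move=> mf mg mu mv fA gA uA vA.
  apply: (tight_subseq sub_oo (X := fun n om => n%:R^-1 * \sum_(1 <= t < n.+1)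
    f t%:Z om * g t%:Z om * u t%:Z om * v t%:Z om)).
  apply: (@tight_mean _ _ _ _ (fun t om =>
    f t%:Z om * g t%:Z om * u t%:Z om * v t%:Z om) (A + A + A + A)) => t.
    by do 3 apply: measurable_funM => //.
  exact: mean_normr_mul4.
have t1 := avg x (fun t => x (t + s%:Z)) (fun t => x (t + s%:Z))
  (fun t om => eps t om i 0)
  mx (fun t => mx _) (fun t => mx _) (fun t => meps t i)
  x_moment4 (fun t => x_moment4 _) (fun t => x_moment4 _) (fun t => eps_moment4 t i).
have t2 := avg x x (fun t => x (t + s%:Z)) (fun t om => eps (t + s%:Z) om j 0)
  mx mx (fun t => mx _) (fun t => meps _ j)
  x_moment4 x_moment4 (fun t => x_moment4 _) (fun t => eps_moment4 _ j).
have t3 := avg x x (fun t => x (t + s%:Z)) (fun t => x (t + s%:Z))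
  mx mx (fun t => mx _) (fun t => mx _)
  x_moment4 x_moment4 (fun t => x_moment4 _) (fun t => x_moment4 _).
have corr1 := tight_mul_cvg0 (tightN t1) (b0 j).
have corr2 := tight_mul_cvg0 (tightN t2) (b0 i).
have corr3 := tight_mul_cvg0 (tightM t3 (cvg_prob_tight (b0 i))) (b0 j).
have := cvg_probD (cvg_probD (cvg_probD main corr1) corr2) corr3.
rewrite !addr0; apply: cvg_prob_eq; apply: nearW => n; apply/funext => om.
rewrite (Chs_hatE _ model).
have rearrange (c b1 b2 s1 s2 s3 : R) :
  c + - s1 * b2 + - s2 * b1 + s3 * b1 * b2 =
  c - b2 * s1 - b1 * s2 + b1 * (b2 * s3) by ring.
exact: rearrange.
Qed.

Lemma VI_hat_cvg (C : nat -> 'M[R]_w) : (0 < h)%N ->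
  (forall s, (s < h)%N -> forall i j, cvg_prob P
    (fun n om => Chs_hat h (n - h) x y s om i j) (C s i j)) ->
  forall i j, cvg_prob P
    (fun n om => VI_hat h (n - h) x y om i j) (VI_of h r C i j).
Proof.
move=> h0 cC i j.
have entryE q (D : nat -> 'M[R]_w) : VI_of h q D i j =
    q^-1 * (D 0%N i j + \sum_(1 <= s < h) (D s i j + D s j i)).
  rewrite /VI_of mxE [X in _ * X]mxE summxE; congr (_ * (_ + _)).
  by apply: eq_bigr => s _; rewrite mxE [X in _ + X]mxE.
rewrite entryE.
have cR := cvg_probV r_neq0 (cvg_prob_subseq (cvg_subnr h) Rhat_cvg).
have cS : cvg_prob P (fun n om => \sum_(1 <= s < h)
    (Chs_hat h (n - h) x y s om i j + Chs_hat h (n - h) x y s om j i))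
    (\sum_(1 <= s < h) (C s i j + C s j i)).
  apply: (cvg_prob_sum (X := fun s n om =>
    Chs_hat h (n - h) x y s om i j + Chs_hat h (n - h) x y s om j i)) => s.
  by rewrite mem_index_iota => /andP[_ sh]; apply: cvg_probD; exact: cC.
apply: cvg_prob_eq (cvg_probM cR (cvg_probD (cC _ h0 i j) cS)).
by apply: nearW => n; apply/funext => om; rewrite /VI_hat entryE.
Qed.

End Asymptotics.

Theorem theorem2 (R : realType) (d : measure_display) (T : measurableType d)
    (P : probability T R) (h w : nat) (h_ge1 : (1 <= h)%N) (w_ge2 : (2 <= w)%N)
    (x : int -> T -> R) (y : int -> T -> 'cV[R]_w)
    (beta : 'cV[R]_w) (eps : int -> T -> 'cV[R]_w)
    (x_stationary : weakly_stationary P (fun t om => \col_(i < 1) x t om))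
    (x_mean0 : mean_zero P (fun t om => \col_(i < 1) x t om))
    (y_stationary : weakly_stationary P y)
    (y_mean0 : mean_zero P y)
    (model : forall (t : int) (om : T),
      y (t + h%:Z) om = x t om *: beta + eps t om)
    (R_neq0 : x_moment2 P x <> 0)
    (MI_indep_t : forall t : int, err_moment P eps t = MI P eps)
    (Chs_indep_t : forall (s : nat) (t : int), (s < h)%N ->
      score_moment P x eps s t = Chs P x eps s)
    (cond1 : bigO_p P (@opnorm R w w)
      (fun n om =>
        n%:R^-1 *: (\sum_(1 <= t < n.+1) eps t%:Z om *m (eps t%:Z om)^T)
        - MI P eps)
      (fun n => (Num.sqrt n%:R)^-1))
    (cond2 : forall s : nat, (s < h)%N ->
      littleo_p P (@opnorm R w w)
        (fun n om =>
          n%:R^-1 *: (\sum_(1 <= t < n.+1)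
            (x t%:Z om *: eps t%:Z om) *m
            (x (t%:Z + s%:Z) om *: eps (t%:Z + s%:Z) om)^T)
          - Chs P x eps s)
        (fun=> 1))
    (cond3 : bigO_p P (@vnorm R w)
      (fun n om =>
        (Num.sqrt n%:R)^-1 *: \sum_(1 <= t < n.+1) x t%:Z om *: eps t%:Z om)
      (fun=> 1))
    (cond4 : littleo_p P (fun r : R => `|r|)
      (fun n om =>
        n%:R^-1 * (\sum_(1 <= t < n.+1) x t%:Z om ^+ 2) - x_moment2 P x)
      (fun=> 1))
    (cond5 : (ereal_sup (range (fun t : int =>
                'E_P[fun om => (vnorm (eps t om) ^+ 4)%R]))
              + ereal_sup (range (fun t : int =>
                'E_P[fun om => (`|x t om| ^+ 4)%R])) < +oo)%E) :
  bigO_p P (@opnorm R w w)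
    (fun n om => MI_hat h (n - h) x y om - MI P eps)
    (fun n => (Num.sqrt n%:R)^-1)
  /\
  littleo_p P (@opnorm R w w)
    (fun n om => VI_hat h (n - h) x y om - VI P h x eps)
    (fun=> 1).
Proof.
have mx t : measurable_fun setT (x t).
  have [/(_ t ord0)/Lfun_measurable + _ _] := x_stationary.
  by under eq_fun do rewrite mxE.
have meps t i : measurable_fun setT (fun om => eps t om i 0).
  have [/(_ (t + h%:Z) i)/Lfun_measurable my _ _] := y_stationary.
  rewrite [X in measurable_fun _ X](_ : _ =
      fun om => y (t + h%:Z) om i 0 - x t om * beta i 0).
    by apply: measurable_funB => //; exact: measurable_funM.
  by apply/funext => om; rewrite model !mxE addrAC subrr add0r.
have m2_neq0 : x_moment2 P x != 0 by exact/eqP.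
have opnorm_ge0 (B : 'M[R]_w) : 0 <= opnorm B.
  by rewrite (le_trans (vnorm_ge0 (B *m 0)))// vnorm_mulmx_le_opnorm ?vnorm0.
have sqrtV_gt0 : \forall n \near \oo, (0 : R) < (Num.sqrt n%:R)^-1.
  by near=> n; rewrite invr_gt0 sqrtr_gt0 ltr0n; near: n; exact: nbhs_infty_gt.
have Rhat_cvg : cvg_prob P (fun n => Rhat n x) (x_moment2 P x).
  have mR : eventually_measurable (fun n om => Rhat n x om - x_moment2 P x).
    apply: nearW => n; apply: measurable_funB => //; apply: measurable_funM => //.
    by apply: measurable_sum => t; exact: measurable_funX.
  move/(littleo_pP _ (@normr_ge0 _ R) (eventually_measurable_norm mR)) : cond4 => c4.
  apply/cvg_prob_sub0; apply: cvg_prob0_le c4 => //.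
  by apply: nearW => n om; rewrite normr_id.
have score_tight i : tight P (fun n om =>
    (Num.sqrt n%:R)^-1 * \sum_(1 <= t < n.+1) x t%:Z om * eps t%:Z om i 0).
  have entryE n om k : ((Num.sqrt n%:R)^-1 *: \sum_(1 <= t < n.+1)
      x t%:Z om *: eps t%:Z om) k 0 =
      (Num.sqrt n%:R)^-1 * \sum_(1 <= t < n.+1) x t%:Z om * eps t%:Z om k 0.
    by rewrite mxE summxE; congr (_ * _); apply: eq_bigr => t _; rewrite mxE.
  apply: tight_eq (bigO_p_tight_entry (i := i) (j := 0) _ _ _ _ _ cond3).
  - by apply: nearW => n; apply/funext => om; rewrite divr1 entryE.
  - exact: vnorm_lipschitz.
  - exact: vnorm_ge0.
  - by move=> v; exact: entry_le_vnorm.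
  - move=> n k l; rewrite (ord1 l); under eq_fun do rewrite entryE.
    apply: measurable_funM => //; apply: measurable_sum => t.
    exact: measurable_funM.
  - exact: nearW.
have [A momA] := expectation_sup_bound (0 : int)
  (fun t om => exprn_ge0 4 (vnorm_ge0 (eps t om)))
  (fun t om => exprn_ge0 4 (normr_ge0 (x t om))) cond5.
have p4E (u : R) : `|u| ^+ 4 = u ^+ 4.
  by rewrite -normrX ger0_norm// (exprM u 2 2) sqr_ge0.
have x_moment4 t : (\int[P]_om (x t om ^+ 4)%:E <= A%:E)%E.
  have [_] := momA t; rewrite unlock; apply: le_trans.
  by under eq_integral do rewrite -p4E.
have eps_moment4 t i : (\int[P]_om (eps t om i 0 ^+ 4)%:E <= A%:E)%E.
  have [+ _] := momA t; rewrite unlock; apply: le_trans.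
  apply: ge0_le_integral => //.
  - by move=> om _; rewrite lee_fin -p4E exprn_ge0.
  - by apply/measurable_EFinP; exact: measurable_funX.
  - apply/measurable_EFinP; apply: measurable_funX.
    apply: measurable_lipschitz => [u v|k l]; first exact: vnorm_lipschitz.
    by rewrite (ord1 l).
  - move=> om _; rewrite lee_fin -p4E lerXn2r// ?nnegrE ?vnorm_ge0//.
    exact: entry_le_vnorm.
have mcross (s n : nat) (c : R) i j : measurable_fun setT (fun om =>
    (c *: (\sum_(1 <= t < n.+1) (x t%:Z om *: eps t%:Z om) *m
      (x (t%:Z + s%:Z) om *: eps (t%:Z + s%:Z) om)^T)) i j).
  under eq_fun => om do rewrite mxE sum_mulmx_trE.
  apply: measurable_funM => //; apply: measurable_sum => t.
  by apply: measurable_funM; under eq_fun do rewrite mxE; exact: measurable_funM.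
split.
  apply: tight_entry_bigO_p => //.
  - exact: opnorm_lipschitz.
  - exact: opnorm_le_sum.
  move=> i j; apply: (MI_hat_tight model m2_neq0 Rhat_cvg score_tight).
  apply: tight_eq (bigO_p_tight_entry (i := i) (j := j) _ _ _ _ _ cond1) => //.
  - by apply: nearW => n; apply/funext => om; rewrite !mxE.
  - exact: opnorm_lipschitz.
  - by move=> B; exact: entry_le_opnorm.
  move=> n k l; under eq_fun => om do rewrite mxE mxE sum_mulmx_trE.
  apply: measurable_funD => //; apply: measurable_funM => //.
  by apply: measurable_sum => t; exact: measurable_funM.
apply: cvg_entry_littleo_p => //.
- exact: opnorm_lipschitz.
- exact: opnorm_le_sum.
apply: (VI_hat_cvg m2_neq0 Rhat_cvg) => // s sh.
apply: (Chs_hat_cvg model mx meps m2_neq0 Rhat_cvg score_tight x_moment4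
  eps_moment4) => i j.
apply: cvg_prob_eq (littleo_p_cvg_entry (i := i) (j := j) _ _ _ _ (cond2 s sh)).
- by apply: nearW => n; apply/funext => om; rewrite mxE.
- exact: opnorm_lipschitz.
- exact: opnorm_ge0.
- by move=> B; exact: entry_le_opnorm.
- by move=> n k l; exact: mcross.
Unshelve. all: by end_near. Qed.
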